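(* Let $F\colon\mathcal C\to\mathcal D$ be any functor between small categories. (1) For every morphism $p\colon\mathbb E\to\mathbb B$ of $\mathcal D$-spaces, $\mathrm{sec}_{\mathcal C}(F^*p)\leq\mathrm{sec}_{\mathcal D}(p)$. (2) For every $\mathcal D$-space $\mathbb X$, $\mathrm{TC}_{\mathcal C}(F^*\mathbb X)\leq\mathrm{TC}_{\mathcal D}(\mathbb X)$.
   Context: $\mathrm{Top}$ is the category of compactly generated topological spaces; products, subspaces and mapping spaces are taken in compactly generated spaces (mapping spaces with the compactly generated compact-open topology). For a small category $\mathcal C$, a $\mathcal C$-space is a functor $\mathbb X\colon\mathcal C\to\mathrm{Top}$; a morphism of $\mathcal C$-spaces ($\mathcal C$-map) is a natural transformation. Products are objectwise; a space $K$ is also regarded as a constant $\mathcal C$-space; $\mathbb I=[0,1]$. A $\mathcal C$-homotopy from $f$ to $g$ (with $f,g\colon\mathbb X\to\mathbb Y$) is a $\mathcal C$-map $H\colon\mathbb X\times\mathbb I\to\mathbb Y$ with $H_0=f$, $H_1=g$; then write $f\simeq_{\mathcal C}g$. For $F\colon\mathcal C\to\mathcal D$, $F^*\colon\mathrm{Top}^{\mathcal D}\to\mathrm{Top}^{\mathcal C}$ is precomposition with $F$: $F^*\mathbb X=\mathbb X\circ F$ and $(F^*p)_c=p_{F(c)}$. An open $\mathcal C$-subspace $\mathbb U\subseteq\mathbb Y$ is a family of open subspaces $\mathbb U(c)\subseteq\mathbb Y(c)$ stable under the structure maps (with restricted structure maps); $\iota_{\mathbb U}\colon\mathbb U\hookrightarrow\mathbb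 Y$ is the inclusion. An open cover of $\mathbb Y$ is a collection $\{\mathbb U_i\}$ of open $\mathcal C$-subspaces with $\mathbb Y(c)=\bigcup_i\mathbb U_i(c)$ for every object $c$. For a $\mathcal C$-map $p\colon\mathbb E\to\mathbb B$, an open $\mathcal C$-subspace $\mathbb U\subseteq\mathbb B$ is sectional for $p$ if there is a $\mathcal C$-map $s\colon\mathbb U\to\mathbb E$ with $p\circ s\simeq_{\mathcal C}\iota_{\mathbb U}$. $\mathrm{sec}_{\mathcal C}(p)$ is the least integer $n\ge0$ such that $\mathbb B$ has an open cover by $n+1$ sectional open $\mathcal C$-subspaces ($\infty$ if none exists). The path $\mathcal C$-space $\mathbb X^{\mathbb I}$ is given by $\mathbb X^{\mathbb I}(c)=\mathrm{Hom}_{\mathrm{Top}}(\mathbb I,\mathbb X(c))$, $\mathbb X^{\mathbb I}(\alpha)(\gamma)=\mathbb X(\alpha)\circ\gamma$; the endpoint evaluation $\pi_{\mathbb X}\colon\mathbb X^{\mathbb I}\to\mathbb X\times\mathbb X$ is $\pi_{\mathbb X,c}(\gamma)=(\gamma(0),\gamma(1))$; and $\mathrm{TC}_{\mathcal C}(\mathbb X)=\mathrm{sec}_{\mathcal C}(\pi_{\mathbb X})$. *)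

(* Defs.v *)
From HB Require Import structures.
From mathcomp Require Import all_boot all_order all_algebra.
From mathcomp Require Import all_classical all_reals all_analysis.
Set Implicit Arguments.
Unset Strict Implicit.
Unset Printing Implicit Defensive.
Import Order.TTheory GRing.Theory Num.Theory numFieldNormedType.Exports.
Local Open Scope classical_set_scope.
Local Open Scope ring_scope.

(* A space is compactly generated when its topology is the final one for all
   continuous maps from compact Hausdorff spaces.  Weak Hausdorffness is not
   required; it is preserved by the products, open subspaces and mapping
   spaces formed below. *)
Definition k_open (X : topologicalType) : set_system X :=
  [set A | forall (K : topologicalType) (u : K -> X),
     compact [set: K] -> hausdorff_space K -> continuous u ->
     open (u @^-1` A)].

HB.mixin Record isCompactlyGenerated X & Topological X := {
  k_open_open : forall A : set X, k_open A -> open A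
}.

#[short(type="cgTopologicalType")]
HB.structure Definition CompactlyGenerated :=
  {X of Topological X & isCompactlyGenerated X}.

(* The points of [X] with the topology of k-open sets; limits in compactly
   generated spaces are obtained by applying it to the usual ones. *)
Definition kify (X : topologicalType) : Type := X.

Section kify.
Variable X : topologicalType.

Let kT : k_open [set: X].
Proof. by move=> K u _ _ _; rewrite preimage_setT; exact: openT. Qed.

Let kI : setI_closed (@k_open X).
Proof.
by move=> A B kA kB K u cK hK cu; apply: openI; [exact: kA|exact: kB].
Qed.

Let kU (I : Type) (f : I -> set X) :
  (forall i, k_open (f i)) -> k_open (\bigcup_i f i).
Proof.
move=> kf K u cK hK cu; rewrite preimage_bigcup; apply: bigcup_open => i _.
exact: kf.
Qed.

HB.instance Definition _ := Choice.on (kify X).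
HB.instance Definition _ := isOpenTopological.Build (kify X) kT kI kU.

Lemma kify_openE (A : set X) : open (A : set (kify X)) = k_open A.
Proof. by []. Qed.

Lemma continuous_kify (K : topologicalType) (u : K -> X) :
  compact [set: K] -> hausdorff_space K -> continuous u ->
  continuous (u : K -> kify X).
Proof.
by move=> cK hK cu; apply/continuousP => A; rewrite kify_openE; exact.
Qed.

Let kify_cg (A : set (kify X)) : k_open A -> open A.
Proof.
move=> kA; rewrite kify_openE => K u cK hK cu.
by apply: kA => //; exact: continuous_kify.
Qed.

HB.instance Definition _ := isCompactlyGenerated.Build (kify X) kify_cg.

Lemma kify_continuous : continuous (idfun : kify X -> X).
Proof.
apply/continuousP => A oA; rewrite kify_openE => K u _ _ /continuousP; exact.
Qed.

End kify.

Lemma cg_continuous_kify (Z : cgTopologicalType) (X : topologicalType)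
  (f : Z -> X) : continuous f -> continuous (f : Z -> kify X).
Proof.
move=> cf; apply/continuousP => A; rewrite kify_openE => kA.
apply: k_open_open => K u cK hK cu; rewrite -comp_preimage; apply: kA => //.
by move=> x; apply: continuous_comp; [exact: cu|exact: cf].
Qed.

Lemma kify_mono (X Y : topologicalType) (f : X -> Y) :
  continuous f -> continuous (f : kify X -> kify Y).
Proof.
move=> cf; apply: cg_continuous_kify => x.
by apply: (continuous_comp (@kify_continuous X x)); exact: cf.
Qed.

(* No universe constraint relates the objects of a category to the carriers of
   spaces, so that [Top] is a [category]; a small category is one as well. *)
Record category := Category {
  obj :> Type ;
  mor : obj -> obj -> Type ;
  idm : forall x, mor x x ;
  cmp : forall x y z, mor y z -> mor x y -> mor x z ;
  cmpA : forall w x y z (h : mor y z) (g : mor x y) (f : mor w x),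
    cmp h (cmp g f) = cmp (cmp h g) f ;
  cmp1m : forall x y (f : mor x y), cmp (idm y) f = f ;
  cmpm1 : forall x y (f : mor x y), cmp f (idm x) = f
}.
Arguments mor {_}.
Arguments idm {_}.
Arguments cmp {_ _ _ _}.

Record functor (C D : category) := Functor {
  fobj :> C -> D ;
  fmor : forall x y, mor x y -> mor (fobj x) (fobj y) ;
  fmor1 : forall x, fmor (idm x) = idm (fobj x) ;
  fmor_cmp : forall x y z (g : mor y z) (f : mor x y),
    fmor (cmp g f) = cmp (fmor g) (fmor f)
}.
Arguments fmor {_ _} _ {_ _}.

Section functor_cmp.
Variables (C D E : category) (G : functor D E) (F : functor C D).

Let fmor1_cmp x : fmor G (fmor F (idm x)) = idm (G (F x)).
Proof. by rewrite !fmor1. Qed.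

Let fmor_cmp_cmp x y z (g : mor y z) (f : mor x y) :
  fmor G (fmor F (cmp g f)) = cmp (fmor G (fmor F g)) (fmor G (fmor F f)).
Proof. by rewrite !fmor_cmp. Qed.

Definition functor_cmp : functor C E := Functor fmor1_cmp fmor_cmp_cmp.
End functor_cmp.

Record nattrans (C D : category) (F G : functor C D) := NatTrans {
  component :> forall x : C, mor (F x) (G x) ;
  naturality : forall (x y : C) (a : mor x y),
    cmp (component y) (fmor F a) = cmp (fmor G a) (component x)
}.

Section nattrans_cmp.
Variables (C D : category) (F G H : functor C D).
Variables (q : nattrans G H) (p : nattrans F G).

Let nat_cmp (x y : C) (a : mor x y) :
  cmp (cmp (q y) (p y)) (fmor F a) = cmp (fmor H a) (cmp (q x) (p x)).
Proof. by rewrite -cmpA naturality !cmpA naturality. Qed.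

Definition nattrans_cmp : nattrans F H := NatTrans nat_cmp.
End nattrans_cmp.

Section whisker.
Variables (C D E : category) (F : functor C D) (G H : functor D E).
Variable p : nattrans G H.

Let whisker_nat (x y : C) (a : mor x y) :
  cmp (p (F y)) (fmor (functor_cmp G F) a) =
  cmp (fmor (functor_cmp H F) a) (p (F x)).
Proof. exact: (naturality p (fmor F a)). Qed.

Definition whisker : nattrans (functor_cmp G F) (functor_cmp H F) :=
  @NatTrans _ _ (functor_cmp G F) (functor_cmp H F) (fun x => p (F x)) whisker_nat.
End whisker.

Definition cts_cmp (X Y Z : topologicalType) (g : continuousType Y Z)
  (f : continuousType X Y) : continuousType X Z := g \o f.

Section Top.
Let topA (W X Y Z : cgTopologicalType) (h : continuousType Y Z)
    (g : continuousType X Y) (f : continuousType W X) :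
  cts_cmp h (cts_cmp g f) = cts_cmp (cts_cmp h g) f.
Proof. exact/continuousEP. Qed.

Let top1m (X Y : cgTopologicalType) (f : continuousType X Y) :
  cts_cmp (idfun : continuousType Y Y) f = f.
Proof. exact/continuousEP. Qed.

Let topm1 (X Y : cgTopologicalType) (f : continuousType X Y) :
  cts_cmp f (idfun : continuousType X X) = f.
Proof. exact/continuousEP. Qed.

Definition Top : category :=
  @Category cgTopologicalType
    (fun X Y : cgTopologicalType => continuousType X Y)
    (fun X => idfun) (fun X Y Z g f => cts_cmp g f) topA top1m topm1.
End Top.

Notation cspace C := (functor C Top).


Section build.
Variable C : category.

Section build_cspace.
Variables (X : C -> cgTopologicalType) (m : forall c d, mor c d -> X c -> X d).
Hypothesis cm : forall c d (a : mor c d), continuous (m a).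
Hypothesis m1 : forall c, m (idm c) =1 id.
Hypothesis mM : forall c d e (b : mor d e) (a : mor c d), m (cmp b a) =1 m b \o m a.

Let fmor_ c d (a : mor c d) : continuousType (X c) (X d) := mkcts (@cm c d a).

Let fmor_1 c : fmor_ (idm c) = idfun.
Proof. exact/continuousEP/m1. Qed.

Let fmor_M c d e (b : mor d e) (a : mor c d) :
  fmor_ (cmp b a) = cts_cmp (fmor_ b) (fmor_ a).
Proof. exact/continuousEP/mM. Qed.

Definition mk_cspace : cspace C := @Functor C Top X fmor_ fmor_1 fmor_M.
End build_cspace.

Section build_cmap.
Variables (X Y : cspace C) (f : forall c, (X c : cgTopologicalType) -> (Y c : cgTopologicalType)).
Hypothesis cf : forall c, continuous (@f c).
Hypothesis nf : forall c d (a : mor c d) (x : X c), f (fmor X a x) = fmor Y a (f x).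

Let comp_ c : continuousType (X c) (Y c) := mkcts (@cf c).

Let comp_nat c d (a : mor c d) :
  cts_cmp (comp_ d) (fmor X a) = cts_cmp (fmor Y a) (comp_ c).
Proof. exact/continuousEP/nf. Qed.

Definition mk_cmap : nattrans X Y := @NatTrans C Top X Y comp_ comp_nat.
End build_cmap.
End build.

Lemma compact_hausdorff_cg (K : topologicalType) :
  compact [set: K] -> hausdorff_space K -> forall A : set K, k_open A -> open A.
Proof. by move=> cK hK A kA; apply: (kA K id) => // x. Qed.

Section unit_interval.
Variable R : realType.

Definition unit_interval : Type := set_type (`[0, 1]%classic : set R).

HB.instance Definition _ := Topological.copy unit_interval
  (initial_topology (set_val : unit_interval -> R)).

Lemma unit_interval_compact : compact [set: unit_interval].
Proof.
move=> F FF _.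
have [p [p01 pF]] : `[(0 : R), 1] `&` cluster ((set_val : unit_interval -> R) @ F) !=set0.
  apply: (@segment_compact R 0 1); rewrite /= /nbhs/=.
  by apply: filterS (@filterT _ F _) => x _; exact: set_valP.
exists (exist _ p (mem_set p01)); split=> // A B FA.
move=> -[W [[V oV VW] Wp] WB]; have Vp : V p by move: Wp; rewrite -VW.
have FVA : ((set_val : unit_interval -> R) @ F) (set_val @` A).
  by rewrite /= /nbhs/=; apply: filterS FA => x Ax; exists x.
have nV : nbhs p V by apply: open_nbhs_nbhs; split.
have [_ [[a Aa <-] Va]] := pF _ _ FVA nV.
by exists a; split=> //; apply: WB; rewrite -VW.
Qed.

Lemma unit_interval_hausdorff : hausdorff_space unit_interval.
Proof.
move=> x y xy; apply: val_inj; apply: (@Rhausdorff R) => A B Ax By.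
have cv : continuous (set_val : unit_interval -> R) by exact: initial_continuous.
have [z [Az Bz]] := xy _ _ (cv _ _ Ax) (cv _ _ By).
by exists (set_val z).
Qed.

HB.instance Definition _ := isCompactlyGenerated.Build unit_interval
  (compact_hausdorff_cg unit_interval_compact unit_interval_hausdorff).

Let i0_subproof : (0 : R) \in (`[0, 1]%classic : set R).
Proof. by rewrite inE/= in_itv/= lexx ler01. Qed.

Let i1_subproof : (1 : R) \in (`[0, 1]%classic : set R).
Proof. by rewrite inE/= in_itv/= lexx ler01. Qed.

Definition i0 : unit_interval := exist _ 0 i0_subproof.
Definition i1 : unit_interval := exist _ 1 i1_subproof.
End unit_interval.

Definition kprod (X Y : cgTopologicalType) : cgTopologicalType :=
  kify (X * Y)%type.

(* The compact-open topology is generated by genuine compact sets of [K]; this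
   agrees with the variant using maps from compact Hausdorff spaces when [K] is
   Hausdorff, in particular for the unit interval. *)
Definition cts_space (K X : topologicalType) : topologicalType :=
  initial_topology (id : continuousType K X -> {compact-open, K -> X}).

Definition mapping_space (K X : topologicalType) : cgTopologicalType :=
  kify (cts_space K X).

Section cts_space.
Variables K X : topologicalType.

Let nbhs_cts_space (g : cts_space K X) (A : set K) (B : set X) :
  compact A -> open B -> (g : continuousType K X) @` A `<=` B ->
  nbhs g [set h : cts_space K X | (h : continuousType K X) @` A `<=` B].
Proof.
move=> cA oB gAB.
pose V : set {compact-open, K -> X} := [set h | h @` A `<=` B].
have nV : nbhs (g : {compact-open, K -> X}) V.
  by apply: open_nbhs_nbhs; split=> //; exact: compact_open_open.
exact: (@initial_continuous _ _
  (id : continuousType K X -> {compact-open, K -> X}) g V nV).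
Qed.

Lemma cts_cmp_continuous (Y : topologicalType) (f : continuousType X Y) :
  continuous (cts_cmp f : mapping_space K X -> mapping_space K Y).
Proof.
apply: (@kify_mono (cts_space K X) (cts_space K Y)).
apply: continuous_comp_initial => g; apply/compact_open_cvgP.
  exact: (@fmap_filter _ _ _ (nbhs g)).
move=> A B cA oB /= fgB.
have ofB : open (f @^-1` B) by move/continuousP: (@cts_fun _ _ f); exact.
have gAB : (g : continuousType K X) @` A `<=` f @^-1` B.
  by move=> _ [x Ax <-]; apply: (fgB (f ((g : continuousType K X) x))); exists x.
apply: (@filterS _ (nbhs g) _ _ _ _ (nbhs_cts_space cA ofB gAB)).
by move=> h /= hB _ [x Ax <-]; exact: (hB _ (imageP _ Ax)).
Qed.

Lemma eval_at_continuous (t : K) :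
  continuous (fun g : mapping_space K X => (g : continuousType K X) t).
Proof.
have cf : continuous (fun g : cts_space K X => (g : continuousType K X) t).
  move=> g U; rewrite {1}nbhsE => -[B [oB Bt] BU].
  have gtB : (g : continuousType K X) @` [set t] `<=` B by move=> _ [_ -> <-].
  apply: (@filterS _ (nbhs g) _ _ _ _ (nbhs_cts_space (@compact_set1 _ t) oB gtB)).
  by move=> h /= hB; apply: BU; apply: hB; exists t.
move=> g; apply: (@continuous_comp (mapping_space K X) (cts_space K X) X idfun
  (fun g => (g : continuousType K X) t)); first exact: kify_continuous.
exact: cf.
Qed.
End cts_space.

Section constant_cspace.
Variables (C : category) (K : cgTopologicalType).

Let map_ (c d : C) (a : mor c d) : K -> K := id.

Let map_continuous c d (a : mor c d) : continuous (map_ a).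
Proof. by move=> x; exact: cvg_id. Qed.

Definition constant_cspace : cspace C :=
  mk_cspace map_continuous (fun _ _ => erefl) (fun _ _ _ _ _ _ => erefl).
End constant_cspace.

Section product_cspace.
Variables (C : category) (X Y : cspace C).

Let map_ c d (a : mor c d) (z : kprod (X c) (Y c)) : kprod (X d) (Y d) :=
  (fmor X a z.1, fmor Y a z.2).

Let map_continuous c d (a : mor c d) : continuous (map_ a).
Proof.
apply: (@kify_mono (X c * Y c)%type (X d * Y d)%type (fun z => (fmor X a z.1, fmor Y a z.2))).
move=> z; apply: cvg_pair.
  by apply: (@continuous_comp _ _ _ fst (fmor X a)); [exact: cvg_fst|exact: cts_fun].
by apply: (@continuous_comp _ _ _ snd (fmor Y a)); [exact: cvg_snd|exact: cts_fun].
Qed.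

Let map_1 c : map_ (idm c) =1 id.
Proof. by case=> x y; rewrite /map_ !fmor1. Qed.

Let map_M c d e (b : mor d e) (a : mor c d) : map_ (cmp b a) =1 map_ b \o map_ a.
Proof. by case=> x y; rewrite /map_ !fmor_cmp. Qed.

Definition product_cspace : cspace C := mk_cspace map_continuous map_1 map_M.
End product_cspace.

(* [F^*] *)
Definition pullback_space (C D : category) (F : functor C D) (X : cspace D) :
  cspace C := functor_cmp X F.

Definition pullback_map (C D : category) (F : functor C D) (X Y : cspace D)
  (p : nattrans X Y) : nattrans (pullback_space F X) (pullback_space F Y) :=
  whisker F p.

Section open_subspace.
Variables (C : category) (Y : cspace C).

Record open_csubspace := OpenCSubspace {
  carrier :> forall c : C, set (Y c : cgTopologicalType) ;
  carrier_open : forall c, open (@carrier c) ;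
  carrier_stable : forall c d (a : mor c d) (y : Y c),
    @carrier c y -> @carrier d (fmor Y a y)
}.
Arguments carrier : clear implicits.

Variable U : open_csubspace.

Let sub_ (c : C) : cgTopologicalType := kify (set_type (U c)).

Let map_mem c d (a : mor c d) (y : sub_ c) : fmor Y a (set_val y) \in U d.
Proof. by apply/mem_set/carrier_stable; exact: set_valP. Qed.

Let map_ c d (a : mor c d) (y : sub_ c) : sub_ d :=
  exist (fun z => z \in U d) _ (map_mem a y).

Let incl_ c (y : sub_ c) : (Y c : cgTopologicalType) := set_val y.

Let incl_continuous c : continuous (@incl_ c).
Proof.
move=> y; apply: (@continuous_comp (sub_ c) (set_type (U c)) (Y c) idfun set_val).
  exact: kify_continuous.
exact: initial_continuous.
Qed.

Let map_continuous c d (a : mor c d) : continuous (map_ a).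
Proof.
apply: (@cg_continuous_kify (sub_ c) (set_type (U d))).
apply: (@continuous_comp_initial _ _ _ (set_val : set_type (U d) -> Y d)) => y.
apply: (@continuous_comp (sub_ c) (Y c) (Y d) (@incl_ c) (fmor Y a)).
  exact: incl_continuous.
exact: cts_fun.
Qed.

Let map_1 c : map_ (idm c) =1 id.
Proof. by move=> y; apply: val_inj; rewrite /= fmor1. Qed.

Let map_M c d e (b : mor d e) (a : mor c d) : map_ (cmp b a) =1 map_ b \o map_ a.
Proof. by move=> y; apply: val_inj; rewrite /= fmor_cmp. Qed.

Definition csubspace : cspace C := mk_cspace map_continuous map_1 map_M.

Definition inclusion : nattrans csubspace Y :=
  @mk_cmap C csubspace Y incl_ incl_continuous (fun _ _ _ _ => erefl).
End open_subspace.

Section path_cspace.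
Variables (R : realType) (C : category) (X : cspace C).

Let map_ c d (a : mor c d) :
  mapping_space (unit_interval R) (X c) -> mapping_space (unit_interval R) (X d) :=
  cts_cmp (fmor X a).

Let map_continuous c d (a : mor c d) : continuous (map_ a).
Proof. exact: cts_cmp_continuous. Qed.

Let map_1 c : map_ (idm c) =1 id.
Proof. by move=> g; apply/continuousEP => t; rewrite /map_ fmor1. Qed.

Let map_M c d e (b : mor d e) (a : mor c d) : map_ (cmp b a) =1 map_ b \o map_ a.
Proof. by move=> g; apply/continuousEP => t; rewrite /map_ fmor_cmp. Qed.

Definition path_cspace : cspace C := mk_cspace map_continuous map_1 map_M.

Let ends (c : C) (g : mapping_space (unit_interval R) (X c)) : kprod (X c) (X c) :=
  ((g : continuousType _ _) (i0 R), (g : continuousType _ _) (i1 R)).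

Let ends_continuous c : continuous (@ends c).
Proof.
apply: (@cg_continuous_kify (mapping_space (unit_interval R) (X c)) (X c * X c)%type).
move=> g.
exact: (cvg_pair (@eval_at_continuous (unit_interval R) (X c) (i0 R) g)
  (@eval_at_continuous (unit_interval R) (X c) (i1 R) g)).
Qed.

Definition endpoints : nattrans path_cspace (product_cspace X X) :=
  @mk_cmap C path_cspace (product_cspace X X) ends ends_continuous
    (fun _ _ _ _ => erefl).
End path_cspace.

Section sec.
Variables (R : realType) (C : category).

Definition homotopic (X Y : cspace C) (f g : nattrans X Y) :=
  exists H : nattrans (product_cspace X (constant_cspace C (unit_interval R))) Y,
    forall (c : C) (x : X c), H c (x, i0 R) = f c x /\ H c (x, i1 R) = g c x.

Variables (E B : cspace C) (p : nattrans E B).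

Definition sectional (U : open_csubspace B) :=
  exists s : nattrans (csubspace U) E,
    homotopic (nattrans_cmp p s) (inclusion U).

(* Covers are families indexed by [n.+1]; repetitions and empty members are
   allowed. *)
Definition sectional_cover (n : nat) :=
  exists U : 'I_n.+1 -> open_csubspace B,
    (forall c, \bigcup_i U i c = [set: B c]) /\ forall i, sectional (U i).

(* [\bar int] serves as the ordered set of integers extended by [+oo]. *)
Definition sec : \bar int :=
  if pselect (exists n, `[< sectional_cover n >]) is left h
  then (ex_minn h)%:Z%:E else +oo%E.
End sec.

Definition TC (R : realType) (C : category) (X : cspace C) : \bar int :=
  sec R (endpoints R X).

(* Main.v *)
Require Import Defs.
From HB Require Import structures.
From mathcomp Require Import all_boot all_order all_algebra.
From mathcomp Require Import all_classical all_reals all_analysis.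

(** Everything in the definition of sectional category is natural in the
    indexing category: precomposition with [F] carries open subspaces to open
    subspaces, sections to sections, homotopies to homotopies and covers to
    covers.  So a cover witnessing the sectional category of [p] pulls back to
    one witnessing that of [F^* p], which gives the first claim.

    For the second, [F^*] commutes with path spaces and with binary products,
    so the endpoint evaluation of [F^* X] is [F^*] of the endpoint evaluation
    of [X], and the first claim applies.  The two sides have the same underlying
    maps but are built with different continuity and functoriality proofs, so
    they are compared by the canonical isomorphisms instead of an equality of
    functors.  The comparison uses that sectional category does not increase
    along a square of maps whose map of bases has a section
    ([sec_le_of_base_retract]). *)

Set Implicit Arguments.
Unset Strict Implicit.
Unset Printing Implicit Defensive.
Local Open Scope classical_set_scope.

Lemma cmap_natural (C : category) (X Y : cspace C) (f : nattrans X Y)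
    (c d : C) (a : mor c d) (x : X c) :
  f d (fmor X a x) = fmor Y a (f c x).
Proof.
exact: (congr1 (fun g : continuousType (X c) (Y d) => g x) (naturality f a)).
Qed.

Lemma sec_le_of_cover (R : realType) (C C' : category)
    (E B : cspace C) (E' B' : cspace C') (p : nattrans E B)
    (p' : nattrans E' B') :
  (forall n, sectional_cover R p n -> sectional_cover R p' n) ->
  (sec R p' <= sec R p)%E.
Proof.
move=> pp'; rewrite /sec; case: (pselect (exists n, `[< sectional_cover R p n >])).
  move=> h; case: pselect => [h'|[]]; last first.
    by case: h => n /asboolP/pp' ?; exists n; apply/asboolP.
  rewrite lee_fin lez_nat; case: (ex_minnP h) => n /asboolP/pp' np' _.
  by case: ex_minnP => m _; apply; apply/asboolP.
by move=> _; rewrite leey.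
Qed.

Section homotopy.
Variables (R : realType) (C : category).

Lemma homotopic_post (X Y Z : cspace C) (q : nattrans Y Z)
    (f g : nattrans X Y) :
  homotopic R f g -> homotopic R (nattrans_cmp q f) (nattrans_cmp q g).
Proof.
case=> H Hfg; exists (nattrans_cmp q H) => c x.
by have [H0 H1] := Hfg c x; split; [exact: (congr1 (q c) H0)|
                                    exact: (congr1 (q c) H1)].
Qed.

Lemma homotopic_ext (X Y : cspace C) (f g f' g' : nattrans X Y) :
  (forall c (x : X c), f c x = f' c x) ->
  (forall c (x : X c), g c x = g' c x) ->
  homotopic R f g -> homotopic R f' g'.
Proof.
move=> ff' gg' [H Hfg]; exists H => c x.
by have [H0 H1] := Hfg c x; rewrite -ff' -gg'.
Qed.

Definition times_interval_fun (W X : cspace C) (r : nattrans W X) (c : C)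
    (z : kprod (W c) (unit_interval R)) : kprod (X c) (unit_interval R) :=
  (r c z.1, z.2).

Lemma times_interval_continuous (W X : cspace C) (r : nattrans W X) (c : C) :
  continuous (@times_interval_fun W X r c).
Proof.
apply: (@kify_mono (W c * unit_interval R)%type (X c * unit_interval R)%type
  (fun z => (r c z.1, z.2))) => z.
apply: (@cvg_pair _ _ _ _ (nbhs (r c z.1)) (nbhs z.2)); last exact: cvg_snd.
by apply: (@continuous_comp _ _ _ fst (r c)); [exact: cvg_fst|exact: cts_fun].
Qed.

Lemma times_interval_natural (W X : cspace C) (r : nattrans W X) (c d : C)
    (a : mor c d)
    (z : product_cspace W (constant_cspace C (unit_interval R)) c) :
  times_interval_fun r
    (fmor (product_cspace W (constant_cspace C (unit_interval R))) a z) =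
  fmor (product_cspace X (constant_cspace C (unit_interval R))) a
    (times_interval_fun r z).
Proof.
by case: z => x t; rewrite /times_interval_fun /= (cmap_natural r a x).
Qed.

Definition times_interval (W X : cspace C) (r : nattrans W X) :
    nattrans (product_cspace W (constant_cspace C (unit_interval R)))
             (product_cspace X (constant_cspace C (unit_interval R))) :=
  @mk_cmap C (product_cspace W (constant_cspace C (unit_interval R)))
    (product_cspace X (constant_cspace C (unit_interval R)))
    (@times_interval_fun W X r) (@times_interval_continuous W X r)
    (@times_interval_natural W X r).

Lemma homotopic_pre (W X Y : cspace C) (f g : nattrans X Y)
    (r : nattrans W X) :
  homotopic R f g -> homotopic R (nattrans_cmp f r) (nattrans_cmp g r).
Proof.
case=> H Hfg; exists (nattrans_cmp H (times_interval r)) => c x.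
exact: (Hfg c (r c x)).
Qed.

End homotopy.

Section preimage.
Variables (C : category) (B' B : cspace C) (w : nattrans B' B).
Variable U : open_csubspace B.

Lemma preimage_open (c : C) : open (w c @^-1` U c).
Proof. by have /continuousP := @cts_fun _ _ (w c); apply; exact: carrier_open. Qed.

Lemma preimage_stable (c d : C) (a : mor c d) (y : B' c) :
  (w c @^-1` U c) y -> (w d @^-1` U d) (fmor B' a y).
Proof.
by move=> Uy; rewrite /= (cmap_natural w); exact: carrier_stable.
Qed.

Definition preimage_csubspace : open_csubspace B' :=
  OpenCSubspace preimage_open preimage_stable.

Definition preimage_restr_fun (c : C) (y : csubspace preimage_csubspace c) :
    csubspace U c :=
  exist (fun z => z \in U c) (w c (set_val y)) (mem_set (set_valP y)).

Lemma preimage_restr_continuous (c : C) : continuous (@preimage_restr_fun c).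
Proof.
apply: (@cg_continuous_kify (csubspace preimage_csubspace c)
  (set_type (U c))).
apply: (@continuous_comp_initial _ _ _ (set_val : set_type (U c) -> B c)) => y.
apply: (@continuous_comp (csubspace preimage_csubspace c) (B' c) (B c)
  (inclusion preimage_csubspace c) (w c)); exact: cts_fun.
Qed.

Lemma preimage_restr_natural (c d : C) (a : mor c d)
    (y : csubspace preimage_csubspace c) :
  preimage_restr_fun (fmor (csubspace preimage_csubspace) a y) =
  fmor (csubspace U) a (preimage_restr_fun y).
Proof. by apply: val_inj; exact: (cmap_natural w a (set_val y)). Qed.

Definition preimage_restr : nattrans (csubspace preimage_csubspace) (csubspace U) :=
  @mk_cmap C (csubspace preimage_csubspace) (csubspace U)
    preimage_restr_fun preimage_restr_continuous preimage_restr_natural.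

End preimage.

(** If [s] is a section up to homotopy of [p] over [U], then [u s w] is one of
    [p'] over the preimage of [U] under [w], since
    [p' u s w = w' p s w ~ w' w = id] there. *)
Lemma sec_le_of_base_retract (R : realType) (C : category)
    (E B E' B' : cspace C) (p : nattrans E B) (p' : nattrans E' B')
    (u : nattrans E E') (w' : nattrans B B') (w : nattrans B' B) :
  (forall c (e : E c), p' c (u c e) = w' c (p c e)) ->
  (forall c (b : B' c), w' c (w c b) = b) ->
  (sec R p' <= sec R p)%E.
Proof.
move=> p'u w'w; apply: sec_le_of_cover => n [U [covU secU]].
exists (fun i => preimage_csubspace w (U i)); split.
  move=> c; apply/seteqP; split=> // b _.
  have [i _ Ub] : (\bigcup_i U i c) (w c b) by rewrite covU.
  by exists i.
move=> i; have [s hs] := secU i.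
exists (nattrans_cmp u (nattrans_cmp s (preimage_restr w (U i)))).
apply: homotopic_ext
  (homotopic_post w' (homotopic_pre (preimage_restr w (U i)) hs)) => c x.
  by rewrite /= p'u.
exact: w'w.
Qed.

Section pullback.
Variables (R : realType) (C D : category) (F : functor C D).

Section pullback_csubspace.
Variables (B : cspace D) (U : open_csubspace B).

Definition pullback_csubspace : open_csubspace (pullback_space F B) :=
  @OpenCSubspace C (pullback_space F B) (fun c => U (F c))
    (fun c => @carrier_open D B U (F c))
    (fun c d a y => @carrier_stable D B U (F c) (F d) (fmor F a) y).

(** The identity on underlying spaces, as a comparison between the subspace of
    the pullback and the pullback of the subspace. *)
Definition pullback_csubspace_map :
    nattrans (csubspace pullback_csubspace) (pullback_space F (csubspace U)).
Proof.
refine (@mk_cmap C (csubspace pullback_csubspace)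
  (pullback_space F (csubspace U)) (fun c y => y) _ _).
- by move=> c y; exact: cvg_id.
- by move=> c d a y; apply: val_inj.
Defined.

End pullback_csubspace.

Lemma homotopic_pullback (X Y : cspace D) (f g : nattrans X Y) :
  homotopic R f g -> homotopic R (pullback_map F f) (pullback_map F g).
Proof.
case=> H Hfg.
pose I := constant_cspace C (unit_interval R).
have nH (c d : C) (a : mor c d) (z : product_cspace (pullback_space F X) I c) :
    H (F d) (fmor (product_cspace (pullback_space F X) I) a z) =
    fmor (pullback_space F Y) a (H (F c) z).
  exact: (cmap_natural H (fmor F a) z).
exists (@mk_cmap C (product_cspace (pullback_space F X) I) (pullback_space F Y)
  (fun c z => H (F c) z) (fun c => @cts_fun _ _ (H (F c))) nH) => c x.
exact: Hfg.
Qed.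

Lemma sectional_pullback (E B : cspace D) (p : nattrans E B)
    (U : open_csubspace B) :
  sectional R p U -> sectional R (pullback_map F p) (pullback_csubspace U).
Proof.
case=> s hs.
exists (nattrans_cmp (pullback_map F s) (pullback_csubspace_map U)).
by apply: homotopic_ext
  (homotopic_pre (pullback_csubspace_map U) (homotopic_pullback hs)).
Qed.

Lemma sec_pullback (E B : cspace D) (p : nattrans E B) :
  (sec R (pullback_map F p) <= sec R p)%E.
Proof.
apply: sec_le_of_cover => n [U [covU secU]].
exists (fun i => pullback_csubspace (U i)); split=> [c|i].
  exact: (covU (F c)).
exact: sectional_pullback.
Qed.

Variable X : cspace D.

Definition pullback_path_map :
    nattrans (pullback_space F (path_cspace R X))
             (path_cspace R (pullback_space F X)).
Proof.
refine (@mk_cmap C (pullback_space F (path_cspace R X))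
  (path_cspace R (pullback_space F X)) (fun c g => g) _ _).
- by move=> c g; exact: cvg_id.
- by [].
Defined.

Definition pullback_prod_map :
    nattrans (pullback_space F (product_cspace X X))
             (product_cspace (pullback_space F X) (pullback_space F X)).
Proof.
refine (@mk_cmap C (pullback_space F (product_cspace X X))
  (product_cspace (pullback_space F X) (pullback_space F X))
  (fun c z => z) _ _).
- by move=> c z; exact: cvg_id.
- by [].
Defined.

Definition prod_pullback_map :
    nattrans (product_cspace (pullback_space F X) (pullback_space F X))
             (pullback_space F (product_cspace X X)).
Proof.
refine (@mk_cmap C (product_cspace (pullback_space F X) (pullback_space F X))
  (pullback_space F (product_cspace X X)) (fun c z => z) _ _).
- by move=> c z; exact: cvg_id.
- by [].
Defined.

(** Paths and pairs in [X (F c)] are the same whether formed before or after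
    pulling back, so the comparison maps are identities on points and the
    square they form with the two endpoint evaluations commutes by
    computation. *)
Lemma TC_pullback_le_sec :
  (TC R (pullback_space F X) <= sec R (pullback_map F (endpoints R X)))%E.
Proof.
by apply: (@sec_le_of_base_retract R C _ _ _ _ _ _
  pullback_path_map pullback_prod_map prod_pullback_map).
Qed.

End pullback.

Theorem proposition6p6 (R : realType) (C D : category) (F : functor C D) :
  (forall (E B : cspace D) (p : nattrans E B),
     (sec R (pullback_map F p) <= sec R p)%E) /\
  (forall X : cspace D,
     (TC R (pullback_space F X) <= TC R X)%E).
Proof.
split=> [E B p|X]; first exact: sec_pullback.
apply: (Order.POrderTheory.le_trans (TC_pullback_le_sec R F X)).
exact: sec_pullback.
Qed.
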